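(* Let $R$ be a commutative ring with identity and $M$ a multiplication $R$-module. Consider the following condition: (C) for any family $\{P_i\}_{i\in I}$ of prime submodules of $M$ and any maximal submodule $K$ of $M$, the inclusion $\bigcap_{i\in I}P_i\subseteq K$ implies $P_j\subseteq K$ for some $j\in I$. If $M$ is coprimely structured, then (C) holds. Conversely, if every family of submodules of $M$ satisfies property ( * ) and (C) holds, then $M$ is coprimely structured.
   Context: All modules are unital. A multiplication module is an $R$-module $M$ such that each submodule $N$ of $M$ is of the form $N=IM$ for some ideal $I$ of $R$. A prime submodule of $M$ is a proper submodule $P$ such that $rm\in P$ with $r\in R$, $m\in M$ implies $m\in P$ or $rM\subseteq P$. A prime submodule $P$ of $M$ is called coprimely structured if for every family $\{N_i\}_{i\in I}$ of submodules of $M$ with $N_i+P=M$ for all $i\in I$, one has $\bigcap_{i\in I}N_i\not\subseteq P$. An $R$-module is called coprimely structured if each of its prime submodules is coprimely structured. The radical $\text{rad}(N)$ of a submodule $N$ of $M$ is the intersection of all prime submodules of $M$ containing $N$ (equal to $M$ if there are none). In a multiplication module $M$, the product of submodules $N=IM$ and $K=JM$ is $(IJ)M$ (this is independent of the choice of $I,J$), and the product of elements $m,m'\in M$ is the product of the submodules $Rm$ and $Rm'$; thus, for $x\in M$ with $Rx=IM$, $x^n$ denotes the submodule $I^nM$. A family $\{N_i\}_{i\in I}$ of submodules of a multiplication module $M$ satisfies property ( * ) if for each $x\in M$ there is an $n\in\mathbb{N}$ such that, for all $i\in I$, $x\in\text{rad}(N_i)$ implies $x^n\subseteq N_i$. 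*)

(* Defs.v *)
From mathcomp Require Import all_boot all_algebra.
From mathcomp Require Import mathcomp_extra boolp classical_sets.

Set Implicit Arguments.
Unset Strict Implicit.
Unset Printing Implicit Defensive.

Import GRing.Theory.
Local Open Scope classical_set_scope.
Local Open Scope ring_scope.

(* Ideals of R, the unit ideal included, are the submodules of R^o. *)
Definition is_submodule (R : comPzRingType) (M : lmodType R) (N : set M) : Prop :=
  GRing.submod_closed [in N].

Definition cyclic_submodule (R : comPzRingType) (M : lmodType R) (x : M) : set M :=
  [set a *: x | a in [set: R]].

Definition submodule_add (R : comPzRingType) (M : lmodType R) (N P : set M) : set M :=
  [set x + y | x in N & y in P].

(* IN is generated by the products a *: m; for M = R^o it is the product of
   two ideals. *)
Definition ideal_smul (R : comPzRingType) (M : lmodType R)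
    (I : set R^o) (N : set M) : set M :=
  smallest (@is_submodule R M) [set a *: m | a in (I : set R) & m in N].

Fixpoint ideal_pow (R : comPzRingType) (I : set R^o) (n : nat) : set R^o :=
  if n is k.+1 then ideal_smul I (ideal_pow I k) else setT.

Definition multiplication_module (R : comPzRingType) (M : lmodType R) : Prop :=
  forall N : set M, is_submodule N ->
    exists2 I : set R^o, is_submodule I & N = ideal_smul I [set: M].

Definition prime_submodule (R : comPzRingType) (M : lmodType R) (P : set M) : Prop :=
  [/\ is_submodule P, P <> setT &
      forall (r : R) (m : M), P (r *: m) -> P m \/ (forall m' : M, P (r *: m'))].

Definition maximal_submodule (R : comPzRingType) (M : lmodType R) (K : set M) : Prop :=
  [/\ is_submodule K, K <> setT &
      forall L : set M, is_submodule L -> K `<=` L -> L = K \/ L = setT].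

Definition coprimely_structured_submodule (R : comPzRingType) (M : lmodType R)
    (P : set M) : Prop :=
  forall (I : Type) (N : I -> set M),
    (forall i, is_submodule (N i)) ->
    (forall i, submodule_add (N i) P = setT) ->
    ~ (\bigcap_i N i `<=` P).

Definition coprimely_structured (R : comPzRingType) (M : lmodType R) : Prop :=
  forall P : set M, prime_submodule P -> coprimely_structured_submodule P.

Definition rad (R : comPzRingType) (M : lmodType R) (N : set M) : set M :=
  \bigcap_(P in [set P | prime_submodule P /\ N `<=` P]) P.

(* A chosen ideal I with N = IM; the default setT is never used for a submodule
   N of a multiplication module. *)
Definition presenting_ideal (R : comPzRingType) (M : lmodType R) (N : set M) : set R^o :=
  xget setT [set I : set R^o | is_submodule I /\ N = ideal_smul I [set: M]].

(* x^n = I^n M where Rx = IM; elt_powE shows that the choice of I is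
   irrelevant. *)
Definition elt_pow (R : comPzRingType) (M : lmodType R) (x : M) (n : nat) : set M :=
  ideal_smul (ideal_pow (presenting_ideal (cyclic_submodule x)) n) [set: M].

Definition property_star (R : comPzRingType) (M : lmodType R)
    (I : Type) (N : I -> set M) : Prop :=
  forall x : M, exists n : nat,
    forall i : I, rad (N i) x -> elt_pow x n `<=` N i.

Definition prime_avoidance_at_maximal (R : comPzRingType) (M : lmodType R) : Prop :=
  forall (I : Type) (P : I -> set M) (K : set M),
    (forall i, prime_submodule (P i)) -> maximal_submodule K ->
    \bigcap_i P i `<=` K -> exists j : I, P j `<=` K.

Lemma is_submoduleP (R : comPzRingType) (M : lmodType R) (N : set M) :
  is_submodule N <-> N 0 /\ forall (a : R) u v, N u -> N v -> N (a *: u + v).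
Proof.
split=> [[/set_mem N0 Nl]|[N0 Nl]]; split=> //.
- by move=> a u v Nu Nv; apply: set_mem; apply: Nl; exact: mem_set.
- exact: mem_set.
- by move=> a u v /set_mem Nu /set_mem Nv; apply: mem_set; exact: Nl.
Qed.

Lemma is_submodule_ideal_smul (R : comPzRingType) (M : lmodType R)
  (I : set R^o) (N : set M) : is_submodule (ideal_smul I N).
Proof.
apply/is_submoduleP; split=> [L [/is_submoduleP[L0 _] _] //|a u v Nu Nv L LP].
have /is_submoduleP[_ Ll] := LP.1.
by apply: Ll; [apply: Nu|apply: Nv].
Qed.

Lemma mem_ideal_smul (R : comPzRingType) (M : lmodType R)
    (I : set R^o) (N : set M) (a : R) m :
  I a -> N m -> ideal_smul I N (a *: m).
Proof. by move=> Ia Nm; apply: sub_gen_smallest; exists a => //; exists m. Qed.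

Lemma ideal_smul_sub (R : comPzRingType) (M : lmodType R)
    (I : set R^o) (N L : set M) :
  is_submodule L -> (forall (a : R) m, I a -> N m -> L (a *: m)) ->
  ideal_smul I N `<=` L.
Proof.
move=> Lsub IN; apply: smallest_sub => // y [a Ia [m Nm <-]]; exact: IN.
Qed.

Lemma is_submodule_preim_scale (R : comPzRingType) (M : lmodType R)
    (a : R) (L : set M) : is_submodule L -> is_submodule [set y | L (a *: y)].
Proof.
move=> /is_submoduleP[L0 Ll]; apply/is_submoduleP; split=> /= [|b u v Lu Lv].
  by rewrite scaler0.
by rewrite scalerDr scalerA mulrC -scalerA; exact: Ll.
Qed.

Lemma is_submodule_preim_scale_elt (R : comPzRingType) (M : lmodType R)
    (m : M) (L : set M) :
  is_submodule L -> is_submodule [set c : R^o | L ((c : R) *: m)].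
Proof.
move=> /is_submoduleP[L0 Ll]; apply/is_submoduleP; split=> /= [|b u v Lu Lv].
  by rewrite scale0r.
by rewrite scalerDl -scalerA; exact: Ll.
Qed.

Lemma ideal_smulA (R : comPzRingType) (M : lmodType R)
    (I J : set R^o) (N : set M) :
  ideal_smul (ideal_smul I J) N = ideal_smul I (ideal_smul J N).
Proof.
rewrite eqEsubset; split; apply: ideal_smul_sub; try exact: is_submodule_ideal_smul.
  move=> c m IJc Nm.
  suff sub : ideal_smul I J `<=` [set c : R^o |
      ideal_smul I (ideal_smul J N) ((c : R) *: m)] by exact: sub IJc.
  apply: ideal_smul_sub.
    by apply: is_submodule_preim_scale_elt; exact: is_submodule_ideal_smul.
  move=> a b Ia Jb /=; rewrite -scalerA; apply: mem_ideal_smul => //.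
  exact: mem_ideal_smul.
move=> a y Ia Jy.
suff sub : ideal_smul J N `<=` [set y | ideal_smul (ideal_smul I J) N (a *: y)].
  exact: sub Jy.
apply: ideal_smul_sub.
  by apply: is_submodule_preim_scale; exact: is_submodule_ideal_smul.
move=> b m Jb Nm /=; rewrite scalerA; apply: mem_ideal_smul => //.
exact: (@mem_ideal_smul R R^o).
Qed.

Lemma ideal_smulCA (R : comPzRingType) (M : lmodType R)
    (I J : set R^o) (N : set M) :
  ideal_smul I (ideal_smul J N) = ideal_smul J (ideal_smul I N).
Proof.
have sub I' J' :
    ideal_smul I' (ideal_smul J' N) `<=` ideal_smul J' (ideal_smul I' N).
  apply: ideal_smul_sub; first exact: is_submodule_ideal_smul.
  move=> a y Ia Jy.
  suff sub : ideal_smul J' N `<=`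
      [set y | ideal_smul J' (ideal_smul I' N) (a *: y)] by exact: sub Jy.
  apply: ideal_smul_sub.
    by apply: is_submodule_preim_scale; exact: is_submodule_ideal_smul.
  move=> b m Jb Nm /=; rewrite scalerA mulrC -scalerA.
  by apply: mem_ideal_smul => //; exact: mem_ideal_smul.
by rewrite eqEsubset; split; exact: sub.
Qed.

Lemma ideal_pow_smul_indep (R : comPzRingType) (M : lmodType R)
    (I J : set R^o) (n : nat) :
  ideal_smul I [set: M] = ideal_smul J [set: M] ->
  ideal_smul (ideal_pow I n) [set: M] = ideal_smul (ideal_pow J n) [set: M].
Proof.
move=> IJ; elim: n => [//|n IHn] /=.
by rewrite !ideal_smulA IHn ideal_smulCA IJ ideal_smulCA.
Qed.

Lemma elt_powE (R : comPzRingType) (M : lmodType R) (x : M) (I : set R^o) (n : nat) :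
  is_submodule I -> cyclic_submodule x = ideal_smul I [set: M] ->
  elt_pow x n = ideal_smul (ideal_pow I n) [set: M].
Proof.
move=> Isub xI; apply: ideal_pow_smul_indep; rewrite -xI /presenting_ideal.
case: xgetP => [J _ [_ <-] //|noI].
by have := noI I; case.
Qed.

(* Main.v *)
Require Import Defs.
From mathcomp Require Import all_boot all_algebra.
From mathcomp Require Import mathcomp_extra boolp classical_sets.

(** A maximal submodule is prime, so coprime structure applied to it gives (C).
    For the converse, let the [N_i] be comaximal with a prime [P], and let [K] be
    a maximal submodule containing [P]. No prime above any [N_i] lies in [K], so
    (C) yields an [x] outside [K] lying in every [rad N_i]. By (star) some power
    [x^n] lies in every [N_i]; if the intersection of the [N_i] were inside [P],
    then [x^n] would be inside the prime [K], and so would [x]. *)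

Set Implicit Arguments.
Unset Strict Implicit.
Unset Printing Implicit Defensive.

Import GRing.Theory.
Local Open Scope classical_set_scope.
Local Open Scope ring_scope.

Section Submodules.
Variables (R : comPzRingType) (M : lmodType R).
Implicit Types (N K P L : set M) (I : set R^o).

Lemma submodule0 N : is_submodule N -> N 0.
Proof. by case/is_submoduleP. Qed.

Lemma submoduleZ N (a : R) x : is_submodule N -> N x -> N (a *: x).
Proof.
move=> /is_submoduleP[N0 Nl] Nx.
by have := Nl a x 0 Nx N0; rewrite addr0.
Qed.

Lemma submoduleD N x y : is_submodule N -> N x -> N y -> N (x + y).
Proof. by move=> /is_submoduleP[_ Nl] Nx; have := Nl 1 x y Nx; rewrite scale1r. Qed.

Lemma is_submodule_add N P :
  is_submodule N -> is_submodule P -> is_submodule (submodule_add N P).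
Proof.
move=> Ns Ps; apply/is_submoduleP; split.
  by exists 0; [exact: submodule0 | exists 0; [exact: submodule0 | rewrite addr0]].
move=> a u v [x Nx [y Py <-]] [x' Nx' [y' Py' <-]].
exists (a *: x + x'); first by apply: submoduleD => //; exact: submoduleZ.
exists (a *: y + y'); first by apply: submoduleD => //; exact: submoduleZ.
by rewrite scalerDr addrACA.
Qed.

Lemma submodule_add_subr N P : is_submodule N -> P `<=` submodule_add N P.
Proof. by move=> Ns y Py; exists 0; [exact: submodule0|exists y; rewrite ?add0r]. Qed.

Lemma submodule_add_subl N P : is_submodule P -> N `<=` submodule_add N P.
Proof. by move=> Ps x Nx; exists x => //; exists 0; [exact: submodule0|rewrite addr0]. Qed.

Lemma submodule_add_sub N P L :
  is_submodule L -> N `<=` L -> P `<=` L -> submodule_add N P `<=` L.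
Proof. by move=> Ls NL PL _ [x /NL Nx [y /PL Py <-]]; exact: submoduleD. Qed.

(** Serves both for [cyclic_submodule x], where [I] is all of [R], and for the multiples of [x] by a
    maximal ideal. *)
Lemma is_submodule_scale_image I (x : M) :
  is_submodule I -> is_submodule [set a *: x | a in (I : set R)].
Proof.
move=> /is_submoduleP[I0 Il]; apply/is_submoduleP; split.
  by exists 0; rewrite ?scale0r.
move=> a _ _ [b Ib <-] [c Ic <-]; exists (a * b + c); first exact: Il.
by rewrite scalerDl scalerA.
Qed.

Lemma mem_cyclic_submodule (x : M) : cyclic_submodule x x.
Proof. by exists 1; rewrite ?scale1r. Qed.

Lemma maximal_submodule_add N K : maximal_submodule K -> is_submodule N ->
  ~ (N `<=` K) -> submodule_add N K = setT.
Proof.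
move=> [Ks _ Kmax] Ns nNK.
have [NKK|//] := Kmax _ (is_submodule_add Ns Ks) (submodule_add_subr Ns).
by exfalso; apply: nNK; rewrite -NKK; exact: submodule_add_subl.
Qed.

(** If [m] is not in [K], then Rm + K = M; writing m' = am + k gives rm' = a(rm) + rk, which lies in
    [K]. *)
Lemma maximal_submodule_prime K : maximal_submodule K -> prime_submodule K.
Proof.
move=> Kmax; have [Ks KT _] := Kmax; split=> // r m Krm.
have [Km|nKm] := pselect (K m); [by left|right=> m'].
have cs : is_submodule (cyclic_submodule m).
  by apply: is_submodule_scale_image; apply/is_submoduleP.
have /seteqP[_ /(_ m' I)[_ [a _ <-] [k Kk <-]]] :
    submodule_add (cyclic_submodule m) K = setT.
  apply: maximal_submodule_add => // sub.
  by apply: nKm; apply: sub; exact: mem_cyclic_submodule.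
rewrite scalerDr scalerA mulrC -scalerA.
by apply: submoduleD => //; exact: submoduleZ.
Qed.

(** Induction on [n]. If I^n M has an element [y] outside [P], then each [a] in [I] sends [y] into
    [P], and primality puts aM inside [P]. For n = 0 the inclusion contradicts properness. *)
Lemma prime_submodule_ideal_pow P I n : prime_submodule P ->
  ideal_smul (ideal_pow I n) [set: M] `<=` P -> ideal_smul I [set: M] `<=` P.
Proof.
move=> [Ps PT Pp]; elim: n => [|n IHn] /=.
  move=> TP; exfalso; apply: PT; rewrite -subTset => x _.
  by rewrite -(scale1r x); apply: TP; exact: mem_ideal_smul.
rewrite ideal_smulA => IIP.
have [/IHn //|/nonsubset[y [Iy nPy]]] :=
  pselect (ideal_smul (ideal_pow I n) [set: M] `<=` P).
apply: ideal_smul_sub => // a m Ia _.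
by have [//|] := Pp a y (IIP _ (mem_ideal_smul Ia Iy)).
Qed.

End Submodules.

Lemma ideal_eq_setT (R : comPzRingType) (J : set R^o) :
  is_submodule J -> J 1 -> J = setT.
Proof.
move=> Js J1; rewrite -subTset => a _.
by have := submoduleZ (a : R) Js J1; rewrite [_ *: _]mulr1.
Qed.

(** Krull's theorem: for an ideal, being proper means avoiding 1, a condition that survives unions
    of chains. *)
Lemma ideal_sub_maximal (R : comPzRingType) (J : set R^o) :
  is_submodule J -> ~ J 1 ->
  exists2 m : set R^o, maximal_submodule m & J `<=` m.
Proof.
move=> Js nJ1.
(* Ordering the sets A by J `|` A makes the empty chain harmless. *)
pose Q := [set A : set R^o | is_submodule (J `|` A) /\ ~ A 1].
have [F FQ Ftot|A [[As nA1] Amax]] := @Zorn_bigcup _ Q.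
  split; last by move=> [A /FQ[_ nA1] A1].
  apply/is_submoduleP; split; first by left; exact: submodule0.
  (* Closure is checked inside a single member of the chain; elements of two members both lie in the
     larger one. *)
  have step A (a : R) u v : F A -> (J `|` A) u -> (J `|` A) v ->
      (J `|` \bigcup_(X in F) X) (a *: u + v).
    move=> FA Au Av; have [As _] := FQ _ FA.
    by have [|Auv] := submoduleD As (submoduleZ a As Au) Av; [left|right; exists A].
  move=> a u v [Ju|[A FA Au]] [Jv|[B FB Bv]].
  - by left; apply: submoduleD => //; exact: submoduleZ.
  - by apply: (step B) => //; [left|right].
  - by apply: (step A) => //; [right|left].
  - have [AB|BA] := Ftot _ _ FA FB.
      by apply: (step B) => //; right=> //; exact: AB.
    by apply: (step A) => //; right=> //; exact: BA.
exists (J `|` A); last exact: subsetUl.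
split=> // [JAT|L Ls JAL].
  by have [] : (J `|` A) 1 by rewrite JAT.
have [L1|nL1] := pselect (L 1); [by right; exact: ideal_eq_setT|left].
have AL : A `<=` L by move=> x Ax; apply: JAL; right.
apply/seteqP; split=> // x Lx; right; apply: contrapT => nAx.
(* An [x] in [L] outside [A] would make [L] a strictly larger member of [Q]. *)
apply: (Amax L); first by split=> // LA; apply: nAx; exact: LA.
split=> //; suff -> : J `|` L = L by [].
by apply/setUidPr => y Jy; apply: JAL; left.
Qed.

(** For [x] outside [N], let [m] be a maximal ideal containing (N : x); then mM is a maximal
    submodule containing [N]. *)
Lemma multiplication_module_maximal (R : comPzRingType) (M : lmodType R)
    (N : set M) : multiplication_module M -> is_submodule N -> N <> setT ->
  exists2 K : set M, maximal_submodule K & N `<=` K.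
Proof.
move=> hM Ns NT.
have /setTPn[x nNx] : N != setT by exact/eqP.
pose J : set R^o := [set c : R^o | N ((c : R) *: x)].
have Js : is_submodule J by exact: is_submodule_preim_scale_elt.
have [|m mmax Jm] := ideal_sub_maximal Js; first by rewrite /J /= scale1r.
have [ms mT _] := mmax.
have nm1 : ~ m 1 by move=> m1; apply: mT; exact: ideal_eq_setT.
have sub_or_add (L : set R^o) : is_submodule L -> ~ (L `<=` m) ->
    exists l p : R, [/\ L l, m p & l + p = 1].
  move=> Ls nLm; have := maximal_submodule_add mmax Ls nLm.
  by move=> /seteqP[_ /(_ 1 I)[l Ll [p mp lp]]]; exists l, p.
have Ksub : is_submodule (ideal_smul m [set: M]) by exact: is_submodule_ideal_smul.
exists (ideal_smul m [set: M]).
  split=> // [mMT|L Ls mML].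
    (* If mM = M and Rx = IM, then Rx = ImM = m x, so some 1 - p with p in m
       kills x; but m contains the annihilator of x modulo N. *)
    have cs : is_submodule (cyclic_submodule x).
      by apply: is_submodule_scale_image; apply/is_submoduleP.
    have [I _ xI] := hM _ cs.
    have mx : ideal_smul m (cyclic_submodule x) `<=`
        [set a *: x | a in (m : set R)].
      apply: ideal_smul_sub; first exact: is_submodule_scale_image.
      move=> a _ ma [b _ <-]; exists (b * a); first exact: (submoduleZ b ms ma).
      by rewrite scalerA mulrC.
    have [|p mp px] := mx x.
      by rewrite xI ideal_smulCA mMT -xI; exact: mem_cyclic_submodule.
    have m1p : m (1 - p).
      by apply: Jm; rewrite /J /= scalerBl scale1r px subrr; exact: submodule0.
    by apply: nm1; rewrite -(subrK p 1); exact: (submoduleD ms m1p mp).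
  (* Write L = IM. Either [I] lies in [m] and L = mM, or I + m = R and [L] contains IM + mM = M. *)
  have [I Is LI] := hM L Ls.
  have [Im|nIm] := pselect (I `<=` m).
    left; apply/seteqP; split=> //; rewrite LI.
    by apply: ideal_smul_sub => // a y /Im ma _; exact: mem_ideal_smul.
  right; have [l [p [Il mp lp]]] := sub_or_add I Is nIm.
  rewrite -subTset => y _; rewrite -(scale1r y) -lp scalerDl.
  apply: submoduleD => //; last by apply: mML; exact: mem_ideal_smul.
  by rewrite LI; exact: mem_ideal_smul.
(* With N = IM, the ideal [I] sends [x] into [N], so [I] lies in [J] and hence in [m]. *)
have [I Is NI] := hM N Ns; rewrite NI.
apply: ideal_smul_sub => // a y Ia _; apply: mem_ideal_smul => //.
by apply: Jm; rewrite /J /= NI; exact: mem_ideal_smul.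
Qed.

Theorem theorem4p5 (R : comPzRingType) (M : lmodType R)
    (hM : multiplication_module M) :
  (coprimely_structured M -> prime_avoidance_at_maximal M) /\
  ((forall (I : Type) (N : I -> set M),
      (forall i, is_submodule (N i)) -> property_star N) ->
   prime_avoidance_at_maximal M -> coprimely_structured M).
Proof.
split=> [cs I P K Pp Kmax PK|star avoid P [Ps PT Pp] I N Ns NP NsubP].
  apply: contrapT => /forallNP nPK.
  apply: (cs K (maximal_submodule_prime Kmax) I P) => // i.
    by have [] := Pp i.
  by apply: maximal_submodule_add => //; have [] := Pp i.
have [K Kmax PK] := multiplication_module_maximal hM Ps PT.
have [Ks KT _] := Kmax; have Kp := maximal_submodule_prime Kmax.
(* All primes above some [N i] form one family, indexed by themselves, to which (C) applies. *)
pose above := {Q : set M | prime_submodule Q /\ exists i, N i `<=` Q}.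
have [x radx nKx] : exists2 x, forall i, Defs.rad (N i) x & ~ K x.
  apply: contrapT => nx.
  have [[Q [Qp [i NQ]]]||[Q [Qp [i NQ]]] /= QK] := avoid above sval K _ Kmax.
  - exact: Qp.
  - move=> y Qy; apply: contrapT => nKy; apply: nx; exists y => // i Q [Qp NQ].
    by apply: (Qy (exist _ Q _)) => //; split=> //; exists i.
  (* A prime [Q] above [N i] and inside [K] would give M = N_i + P inside [K]. *)
  - apply: KT; rewrite -subTset -(NP i).
    by apply: submodule_add_sub => //; exact: subset_trans NQ QK.
(* The exponent [n] is the same for all [i], so x^n lies in the whole intersection. *)
have [n powN] := star I N Ns x.
have cyc : is_submodule (cyclic_submodule x).
  by apply: is_submodule_scale_image; apply/is_submoduleP.
have [J Js xJ] := hM _ cyc.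
apply: nKx; suff : ideal_smul J [set: M] `<=` K.
  by rewrite -xJ; apply; exact: mem_cyclic_submodule.
apply: (@prime_submodule_ideal_pow _ _ _ _ n) => //.
rewrite -(elt_powE n Js xJ) => y xny.
by apply: PK; apply: NsubP => i _; apply: powN (radx i) _ xny.
Qed.
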